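(* Let $\mathcal A$ be a well-structured set of quantum assertions and $\mathrm{IN}$ an incorrectness proof system for quantum while-programs with assertions from $\mathcal A$ as described in the context. If $\mathrm{IN}$ is sound and relatively complete, then the induced abstract interpretation is complete: for every program $S$, $\alpha\circ\llbracket S\rrbracket=\llbracket S\rrbracket^\#\circ\alpha$ on $\mathcal Q$.
   Context: Fix a finite set $V$ of quantum variables, each a qubit with state space $\mathcal H_q\cong\mathbb C^2$; for $W\subseteq V$, $\mathcal H_W=\bigotimes_{q\in W}\mathcal H_q$. Operators and subspaces on $\mathcal H_W$ are identified with their cylindrical extensions to $\mathcal H_V$, and a subspace is identified with its orthogonal projector; $P^\perp$ is the orthocomplement. $\mathcal D(\mathcal H_V)$ is the set of partial density operators (positive, trace $\le1$). Programs: $S::=\mathbf{skip}\mid \bar q:=|0\rangle\mid \bar q\mathrel{*{=}}U\mid \mathbf{assert}\ P[\bar q]\mid S_0;S_1\mid \mathbf{if}\ P[\bar q]\ \mathbf{then}\ S_1\ \mathbf{else}\ S_0\ \mathbf{end}\mid\mathbf{while}\ P[\bar q]\ \mathbf{do}\ S\ \mathbf{end}$, with $\bar q=q_1,\dots,q_t$ distinct variables, $U$ unitary on $\mathcal H_{\bar q}$, $P$ a subspace of $\mathcal H_{\bar q}$; the first four forms are the basic commands. Semantics $\llbracket S\rrbracket:\mathcal D(\mathcal H_V)\to\mathcal D(\mathcal H_V)$: $\llbracket\mathbf{skip}\rrbracket(\rho)=\rho$; $\llbracket\bar q:=|0\rangle\rrbracket(\rho)=\sum_{i=0}^{2^t-1}|0\rangle_{\bar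 q}\langle i|\rho|i\rangle_{\bar q}\langle0|$; $\llbracket\bar q\mathrel{*{=}}U\rrbracket(\rho)=U\rho U^\dagger$; $\llbracket\mathbf{assert}\ P[\bar q]\rrbracket(\rho)=P\rho P$; $\llbracket S_0;S_1\rrbracket=\llbracket S_1\rrbracket\circ\llbracket S_0\rrbracket$; $\llbracket\mathbf{if}\ P[\bar q]\ \mathbf{then}\ S_1\ \mathbf{else}\ S_0\ \mathbf{end}\rrbracket(\rho)=\llbracket\mathbf{assert}\ P[\bar q];S_1\rrbracket(\rho)+\llbracket\mathbf{assert}\ P^\perp[\bar q];S_0\rrbracket(\rho)$; $\llbracket\mathbf{while}\ P[\bar q]\ \mathbf{do}\ S\ \mathbf{end}\rrbracket(\rho)=\sum_{i\ge0}\llbracket(\mathbf{assert}\ P[\bar q];S)^i;\mathbf{assert}\ P^\perp[\bar q]\rrbracket(\rho)$, where $T^i$ is $i$-fold sequential composition ($T^0=\mathbf{skip}$). The concrete domain is $\mathcal Q=2^{\mathcal D(\mathcal H_V)}$ ordered by inclusion, and $\llbracket S\rrbracket(R)=\{\llbracket S\rrbracket(\rho):\rho\in R\}$. A complete lattice $(\mathcal A,\le_{\mathcal A},\vee,\wedge,\bot,\top)$ together with a satisfaction relation $\models\subseteq\mathcal D(\mathcal H_V)\times\mathcal A$ such that $a\le_{\mathcal A}a'$ iff every $\rho\models a$ satisfies $\rho\models a'$, is a well-structured set of quantum assertions if (1) whenever $\rho\models a$ for all $a$ in a subset $A\subseteq\mathcal A$, then $\rho\models\bigwedge A$; and (2)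 for any $a\in\mathcal A$, $\rho_i\in\mathcal D(\mathcal H_V)$, reals $x_i>0$ with $\sum_i x_i\rho_i\in\mathcal D(\mathcal H_V)$: $\sum_i x_i\rho_i\models a$ iff $\rho_i\models a$ for all $i$. $\mathrm{IN}$ is a proof system deriving triples $[a]\,S\,[a']$ ($a,a'\in\mathcal A$), consisting of an axiom schema for each basic command, one proof rule for each composite construct, where the rule for sequential composition is: from $[a]\,S_0\,[a']$ and $[a']\,S_1\,[b]$ infer $[a]\,S_0;S_1\,[b]$, and the consequence rule: from $a\le_{\mathcal A}a'$, $[a]\,S\,[b]$, $b'\le_{\mathcal A}b$ infer $[a']\,S\,[b']$. Write $\vdash_{\mathrm{IN}}$ for derivability. Validity: $\models_{\mathrm{IN}}[a]\,S\,[a']$ iff $a'\le_{\mathcal A}\bigwedge\{b\in\mathcal A:\llbracket S\rrbracket(\rho)\models b\text{ for all }\rho\models a\}$. $\mathrm{IN}$ is sound if derivable implies valid, relatively complete if valid implies derivable. Induced abstract interpretation: $\gamma(a)=\{\rho:\rho\models a\}$, $\alpha(R)=\bigwedge\{b\in\mathcal A:R\subseteq\gamma(b)\}$, and $\llbracket S\rrbracket^\#(a)=\bigvee\{a'\in\mathcal A:\vdash_{\mathrm{IN}}[a]\,S\,[a']\}$. *)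

(* Defs.v *)
From HB Require Import structures.
From mathcomp Require Import all_boot all_order all_algebra.
From mathcomp Require Import complex.
From mathcomp Require Import boolp classical_sets reals topology normedtype sequences.

Set Implicit Arguments.
Unset Strict Implicit.
Unset Printing Implicit Defensive.

Import Order.TTheory GRing.Theory Num.Theory.
Import numFieldNormedType.Exports.
Local Open Scope ring_scope.

(* Quantum variables: V = 'I_n (n qubits).  The computational basis of        *)
(* H_W for a register of t qubits is indexed by bas t = {ffun 'I_t -> bool}.  *)
(* Operators on H_W are (2^t x 2^t) complex matrices, represented as          *)
(* functions bas t -> bas t -> R[i].  Complex numbers are R[i] for a          *)
(* R : realType (the reals), so infinite sums (while loops) can be taken.     *)

Definition bas (t : nat) := {ffun 'I_t -> bool}.

Section Quantum.
Variable R : realType.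
Local Notation C := (R[i]).

Definition op (t : nat) := bas t -> bas t -> C.

Definition op0 t : op t := fun _ _ => 0.
Definition op1 t : op t := fun x y => if x == y then 1 else 0.
Definition opD t (A B : op t) : op t := fun x y => A x y + B x y.
Definition opB t (A B : op t) : op t := fun x y => A x y - B x y.
Definition opM t (A B : op t) : op t := fun x y => \sum_(z : bas t) A x z * B z y.
Definition opZ t (c : C) (A : op t) : op t := fun x y => c * A x y.
Definition adj t (A : op t) : op t := fun x y => conjc (A y x).
Definition op_eq t (A B : op t) := forall x y, A x y = B x y.

Definition unitary t (U : op t) := op_eq (opM (adj U) U) (@op1 t).
(* P is (the orthogonal projector onto) a subspace: P = P^dagger = P P *)
Definition projector t (P : op t) := op_eq (adj P) P /\ op_eq (opM P P) P.
Definition ortho t (P : op t) : op t := opB (@op1 t) P.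

Definition psd t (A : op t) :=
  forall v : bas t -> C, 0 <= \sum_(x : bas t) \sum_(y : bas t) conjc (v x) * A x y * v y.
Definition trace t (A : op t) : C := \sum_(x : bas t) A x x.
Definition pdo t (A : op t) := psd A /\ trace A <= 1.

Variable n : nat.

Definition restr (qs : seq 'I_n) (x : bas n) : bas (size qs) :=
  [ffun i => x (tnth (in_tuple qs) i)].

(* cylindrical extension of an operator on H_qs to H_V : A (x) I *)
Definition cyl (qs : seq 'I_n) (A : op (size qs)) : op n :=
  fun x y => A (restr qs x) (restr qs y) *
             (if [forall v : 'I_n, (v \notin qs) ==> (x v == y v)] then 1 else 0).

Definition ket0bra t (i : bas t) : op t :=
  fun x y => if (x == [ffun _ => false]) && (y == i) then 1 else 0.

Inductive prog : Type :=
| Skip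
| Init of seq 'I_n
| Unit (qs : seq 'I_n) of op (size qs)
| Assert (qs : seq 'I_n) of op (size qs)
| Seq of prog & prog
| If (qs : seq 'I_n) of op (size qs) & prog & prog
| While (qs : seq 'I_n) of op (size qs) & prog.

Definition wf_reg (qs : seq 'I_n) := (0 < size qs)%N && uniq qs.

Fixpoint wf (Sb : prog) : Prop :=
  match Sb with
  | Skip => True
  | Init qs => wf_reg qs
  | Unit qs U => wf_reg qs /\ unitary U
  | Assert qs P => wf_reg qs /\ projector P
  | Seq S0 S1 => wf S0 /\ wf S1
  | If qs P S1 S0 => [/\ wf_reg qs, projector P, wf S1 & wf S0]
  | While qs P Sb => [/\ wf_reg qs, projector P & wf Sb]
  end.

Definition sem_assert (qs : seq 'I_n) (P : op (size qs)) (rho : op n) : op n :=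
  opM (opM (cyl P) rho) (cyl P).

Definition climn (u : nat -> C) : C :=
  let re : R := limn (fun k : nat => complex.Re (u k)) in
  let im : R := limn (fun k : nat => complex.Im (u k)) in
  Complex re im.

Fixpoint sem (Sb : prog) (rho : op n) : op n :=
  match Sb with
  | Skip => rho
  | Init qs => fun x y => \sum_(i : bas (size qs))
        opM (opM (cyl (ket0bra i)) rho) (adj (cyl (ket0bra i))) x y
  | Unit qs U => opM (opM (cyl U) rho) (adj (cyl U))
  | Assert qs P => sem_assert P rho
  | Seq S0 S1 => sem S1 (sem S0 rho)
  | If qs P S1 S0 => opD (sem S1 (sem_assert P rho)) (sem S0 (sem_assert (ortho P) rho))
  | While qs P Sb =>
      let body := fun r => sem Sb (sem_assert P r) in
      fun x y => climn (fun N => \sum_(k < N)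
                          sem_assert (ortho P) (iter k body rho) x y)
  end.

Definition sem_set (Sb : prog) (Q : op n -> Prop) : op n -> Prop :=
  fun sigma => exists2 rho, Q rho & sigma = sem Sb rho.

Section Assertions.
Variable A : Type.
Variable sat : op n -> A -> Prop.

Definition ale (a a' : A) := forall rho, pdo rho -> sat rho a -> sat rho a'.

Record well_structured (meet join : (A -> Prop) -> A) : Prop := {
  ws_antisym : forall a b, ale a b -> ale b a -> a = b;
  ws_meet_lb : forall X a, X a -> ale (meet X) a;
  ws_meet_glb : forall X b, (forall a, X a -> ale b a) -> ale b (meet X);
  ws_join_ub : forall X a, X a -> ale a (join X);
  ws_join_lub : forall X b, (forall a, X a -> ale a b) -> ale (join X) b;
  ws_meet_sat : forall X rho, pdo rho -> (forall a, X a -> sat rho a) -> sat rho (meet X);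
  ws_conv : forall a (m : nat) (x : 'I_m.+1 -> R) (rhos : 'I_m.+1 -> op n),
      (forall i, pdo (rhos i)) -> (forall i, 0 < x i) ->
      pdo (fun u v => \sum_(i < m.+1) ((x i)%:C)%C * rhos i u v) ->
      (sat (fun u v => \sum_(i < m.+1) ((x i)%:C)%C * rhos i u v) a <->
       forall i, sat (rhos i) a)
}.

(* Incorrectness proof system IN: axiom schemas for the basic commands,       *)
(* one rule (schema) for each of if / while (with arbitrary, possibly         *)
(* infinite, sets of premises about the sub-programs and arbitrary side       *)
(* conditions), the given rule for sequential composition, and the           *)
(* consequence rule.                                                          *)

Record in_schemas : Type := {
  ax_skip : A -> A -> Prop;
  ax_init : seq 'I_n -> A -> A -> Prop;
  ax_unit : forall qs : seq 'I_n, op (size qs) -> A -> A -> Prop;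
  ax_assert : forall qs : seq 'I_n, op (size qs) -> A -> A -> Prop;
  (* rule_if qs P prem1 prem0 a a' : from [b]S1[b'] for all prem1 b b' and
     [b]S0[b'] for all prem0 b b', infer [a] if P[qs] then S1 else S0 end [a'] *)
  rule_if : forall qs : seq 'I_n, op (size qs) ->
      (A -> A -> Prop) -> (A -> A -> Prop) -> A -> A -> Prop;
  (* rule_while qs P prem a a' : from [b]Sb[b'] for all prem b b',
     infer [a] while P[qs] do Sb end [a'] *)
  rule_while : forall qs : seq 'I_n, op (size qs) ->
      (A -> A -> Prop) -> A -> A -> Prop
}.

Inductive derivable (IN : in_schemas) : prog -> A -> A -> Prop :=
| d_skip a a' : ax_skip IN a a' -> derivable IN Skip a a'
| d_init (qs : seq 'I_n) a a' : ax_init IN qs a a' -> derivable IN (Init qs) a a'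
| d_unit (qs : seq 'I_n) (U : op (size qs)) a a' : ax_unit IN U a a' -> derivable IN (Unit U) a a'
| d_assert (qs : seq 'I_n) (P : op (size qs)) a a' : ax_assert IN P a a' -> derivable IN (Assert P) a a'
| d_seq S0 S1 a a' b :
    derivable IN S0 a a' -> derivable IN S1 a' b -> derivable IN (Seq S0 S1) a b
| d_if (qs : seq 'I_n) (P : op (size qs)) S1 S0 (prem1 prem0 : A -> A -> Prop) a a' :
    rule_if IN P prem1 prem0 a a' ->
    (forall b b', prem1 b b' -> derivable IN S1 b b') ->
    (forall b b', prem0 b b' -> derivable IN S0 b b') ->
    derivable IN (If P S1 S0) a a'
| d_while (qs : seq 'I_n) (P : op (size qs)) Sb (prem : A -> A -> Prop) a a' :
    rule_while IN P prem a a' ->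
    (forall b b', prem b b' -> derivable IN Sb b b') ->
    derivable IN (While P Sb) a a'
| d_cons Sb a a' b b' :
    ale a a' -> derivable IN Sb a b -> ale b' b -> derivable IN Sb a' b'.

Variables (meet join : (A -> Prop) -> A).

Definition valid (Sb : prog) (a a' : A) :=
  ale a' (meet (fun b => forall rho, pdo rho -> sat rho a -> sat (sem Sb rho) b)).

Definition sound (IN : in_schemas) :=
  forall Sb a a', wf Sb -> derivable IN Sb a a' -> valid Sb a a'.
Definition rel_complete (IN : in_schemas) :=
  forall Sb a a', wf Sb -> valid Sb a a' -> derivable IN Sb a a'.

Definition gamma (a : A) : op n -> Prop := fun rho => pdo rho /\ sat rho a.
Definition alpha (Q : op n -> Prop) : A :=
  meet (fun b => forall rho, Q rho -> gamma b rho).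
Definition sem_sharp (IN : in_schemas) (Sb : prog) (a : A) : A :=
  join (fun a' => derivable IN Sb a a').

End Assertions.
End Quantum.

(* Main.v *)
Require Import Defs.
From HB Require Import structures.
From mathcomp Require Import all_boot all_order all_algebra.
From mathcomp Require Import complex.
From mathcomp Require Import boolp classical_sets reals topology normedtype sequences.

(* Soundness and completeness make [sem_sharp S a] the strongest valid
   postcondition [spost S a], so the point is that
   [spost S (alpha Q) <= c] for [c := alpha (sem_set S Q)].

   Programs act linearly on the cone of positive operators, so by the convexity
   condition the states [rho] with [sem S rho] satisfying [c] form a face of the
   set of partial density operators.  In finite dimension a nonempty face
   consists of all [rho] supported in one subspace, i.e. [P rho P = rho] for some
   projector [P].  This face contains [Q].  Let [T] be [assert P] on the full
   register.  As [T] fixes [Q], the triple [top] T [alpha Q] is valid, and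
   [alpha Q] S [spost S (alpha Q)] is valid too.  Completeness, the sequencing
   rule and soundness make [top] T; S [spost S (alpha Q)] valid, while every
   state satisfies [c] after [T; S].  Without qubits no such [T] exists, but then
   every program is the identity. *)

Set Implicit Arguments.
Unset Strict Implicit.
Unset Printing Implicit Defensive.

Import Order.TTheory GRing.Theory Num.Theory.
Import numFieldNormedType.Exports.
Local Open Scope ring_scope.

(** * Positive semidefinite matrices *)

Local Open Scope sesquilinear_scope.

Section PsdMatrix.
Variable C : numClosedFieldType.
Implicit Types (n : nat).

(** Since [0 <=] in [C] includes being real, Hermitian symmetry follows from this definition; see
    [mxpsd_herm]. *)
Definition mxpsd n (M : 'M[C]_n) :=
  forall v : 'rV[C]_n, 0 <= (v *m M *m v^t*) 0 0.

Lemma trmxCM m n p (A : 'M[C]_(m, n)) (B : 'M[C]_(n, p)) :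
  (A *m B)^t* = B^t* *m A^t*.
Proof. by rewrite trmx_mul map_mxM. Qed.

Lemma mxpsd_congr m n (M : 'M[C]_m) (K : 'M[C]_(m, n)) :
  mxpsd M -> mxpsd (K^t* *m M *m K).
Proof.
by move=> Mp v; have := Mp (v *m K^t*); rewrite trmxCM trmxCK !mulmxA.
Qed.

Lemma mxpsdD n (A B : 'M[C]_n) : mxpsd A -> mxpsd B -> mxpsd (A + B).
Proof. by move=> Ap Bp v; rewrite mulmxDr mulmxDl mxE addr_ge0. Qed.

Lemma mxpsdZ n (c : C) (A : 'M[C]_n) : 0 <= c -> mxpsd A -> mxpsd (c *: A).
Proof. by move=> c0 Ap v; rewrite -scalemxAr -scalemxAl mxE mulr_ge0. Qed.

Lemma mxpsd_diag n (d : 'rV[C]_n) :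
  (forall i, 0 <= d 0 i) -> mxpsd (diag_mx d).
Proof.
move=> d0 v; rewrite mul_mx_diag mxE sumr_ge0 // => i _.
by rewrite !mxE mulrAC mulr_ge0 // mul_conjC_ge0.
Qed.

Lemma mx_delta_form n (K : 'M[C]_n) i j :
  ((delta_mx 0 i : 'rV_n) *m K *m (delta_mx 0 j : 'rV_n)^t*) 0 0 = K i j.
Proof.
rewrite -rowE trmx_delta map_delta_mx.
rewrite mxE (bigD1 j) //= big1 => [|k kj]; rewrite !mxE ?eqxx ?mulr1 ?addr0 //.
by rewrite (negbTE kj) mulr0.
Qed.

(* Polarization at [e_i + c e_j] with [c = 1] and [c = 'i]. *)
Lemma quad_form_eq0 n (K : 'M[C]_n) :
  (forall v : 'rV[C]_n, (v *m K *m v^t*) 0 0 = 0) -> K = 0.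
Proof.
move=> K0.
have E := mx_delta_form K.
have Eii i : K i i = 0 by rewrite -E K0.
apply/matrixP => i j; rewrite [RHS]mxE.
have P c : c^* * K i j + c * K j i = 0.
  have := K0 (delta_mx 0 i + c *: delta_mx 0 j).
  rewrite linearD linearZ /= map_mxD map_mxZ /=.
  rewrite !(mulmxDl, mulmxDr) -!(scalemxAl, scalemxAr).
  have D (A B : 'M[C]_1) : (A + B) 0 0 = A 0 0 + B 0 0 by rewrite mxE.
  have Z a (A : 'M[C]_1) : (a *: A) 0 0 = a * A 0 0 by rewrite mxE.
  by rewrite !(D, Z) !E !Eii !(mulr0, add0r, addr0).
have := P 1; have := P 'i; rewrite conjC1 conjCi !mul1r mulNr addrC -mulrBr.
move/eqP; rewrite mulf_eq0 (negbTE (neq0Ci C)) /= subr_eq0 => /eqP ->.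
by rewrite -mulr2n => /eqP; rewrite mulrn_eq0 /= => /eqP.
Qed.

(** The form of [M^t* - M] at [v] is the conjugate of a real number minus that number, so
    [quad_form_eq0] applies. *)
Lemma mxpsd_herm n (M : 'M[C]_n) : mxpsd M -> M^t* = M.
Proof.
move=> Mp; apply/eqP; rewrite -subr_eq0; apply/eqP; apply: quad_form_eq0 => v.
rewrite mulmxBr mulmxBl.
have -> : v *m M^t* *m v^t* = (v *m M *m v^t*)^t*.
  by rewrite !trmxCM trmxCK mulmxA.
have -> (A : 'M[C]_1) : (A^t* - A) 0 0 = (A 0 0)^* - A 0 0 by rewrite !mxE.
by rewrite (CrealP (ger0_real (Mp v))) subrr.
Qed.

Lemma mxpsd_spectral n (M : 'M[C]_n) : mxpsd M ->
  exists2 U : 'M[C]_n, U *m U^t* = 1%:M /\ U^t* *m U = 1%:M &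
  exists2 d : 'rV[C]_n, (forall i, 0 <= d 0 i) & M = U^t* *m diag_mx d *m U.
Proof.
move=> Mp; have Mh := mxpsd_herm Mp.
have /orthomx_spectralP E : M \is normalmx by apply/normalmxP; rewrite Mh.
set U := spectralmx M in E; set d := spectral_diag M in E.
have Uu : U \is unitarymx := spectral_unitarymx M.
have UU : U *m U^t* = 1%:M by apply/unitarymxP.
have UU' := mulmx1C UU.
have {}E : M = U^t* *m diag_mx d *m U by rewrite -invmx_unitary.
exists U => //; exists d => // i.
(* The eigenvalue [d 0 i] is the value of the form at row [i] of [U]. *)
have := mxpsd_congr (U^t*) Mp (delta_mx 0 i).
rewrite mx_delta_form E trmxCK !mulmxA UU mul1mx -mulmxA UU mulmx1.
by rewrite mxE eqxx mulr1n.
Qed.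

(** In eigencoordinates [w] the form is a sum of nonnegative terms [d_i |w_i|^2]; if it vanishes, so
    does every [w_i d_i]. *)
Lemma mxpsd_form_eq0 n (M : 'M[C]_n) (v : 'rV[C]_n) : mxpsd M ->
  (v *m M *m v^t*) 0 0 = 0 -> v *m M = 0.
Proof.
move=> /mxpsd_spectral[U [UU UU'] [d d0 ->]].
set w := v *m U^t*.
have -> : v *m (U^t* *m diag_mx d *m U) *m v^t* = w *m diag_mx d *m w^t*.
  by rewrite /w trmxCM trmxCK !mulmxA.
rewrite !mulmxA -/w mul_mx_diag mxE => /eqP.
rewrite psumr_eq0 => [/allP w0|i _]; last first.
  by rewrite !mxE mulrAC mulr_ge0 // mul_conjC_ge0.
rewrite [X in X *m U](_ : _ = 0) ?mul0mx //.
apply/rowP => i; have /implyP/(_ isT) := w0 i (mem_index_enum i).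
by rewrite !mxE mulrAC mulf_eq0 mul_conjC_eq0 => /orP[] /eqP ->; rewrite ?mul0r ?mulr0.
Qed.

Lemma mxpsd_le_scalar n (M : 'M[C]_n) : mxpsd M ->
  exists2 c : C, 0 <= c & mxpsd (c%:M - M).
Proof.
move=> /mxpsd_spectral[U [UU UU'] [d d0 ->]].
exists (\sum_i d 0 i); first exact: sumr_ge0.
have -> : (\sum_i d 0 i)%:M - U^t* *m diag_mx d *m U =
          U^t* *m diag_mx (\row_j (\sum_i d 0 i - d 0 j)) *m U.
  have -> : diag_mx (\row_j (\sum_i d 0 i - d 0 j)) = (\sum_i d 0 i)%:M - diag_mx d.
    by apply/matrixP => i j; rewrite !mxE -mulrnBl.
  by rewrite mulmxBr mulmxBl mul_mx_scalar -scalemxAl UU' scalemx1.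
apply: mxpsd_congr; apply: mxpsd_diag => j.
by rewrite mxE subr_ge0 (bigD1 j) //= lerDl sumr_ge0.
Qed.

(** [P] is the spectral projector for the nonzero eigenvalues of [M]. From [rho <= c] follows
    [P rho P <= c P], and [P] is below a multiple of [M] because [M] is bounded below on its
    support. *)
Lemma mxpsd_support n (M : 'M[C]_n) : mxpsd M ->
  exists2 P : 'M[C]_n, [/\ P^t* = P, P *m P = P & (1%:M - P) *m M = 0] &
  forall rho : 'M[C]_n, mxpsd rho ->
    exists2 k : C, 0 < k & mxpsd (k *: M - P *m rho *m P).
Proof.
move=> /mxpsd_spectral[U [UU UU'] [d d0 EM]].
pose chi : 'rV[C]_n := \row_j (d 0 j != 0)%:R.
pose S (e : 'rV[C]_n) := U^t* *m diag_mx e *m U.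
have SM e f : S e *m S f = S (\row_j (e 0 j * f 0 j)).
  by rewrite /S -mulmx_diag !mulmxA -[X in X *m _ *m _](mulmxA _ U) UU mulmx1.
have SL a e f : a *: S e + S f = S (a *: e + f).
  by rewrite /S [diag_mx (_ + _)]linearP mulmxDr mulmxDl -scalemxAr -scalemxAl.
have chiM (e : 'rV[C]_n) : (forall j, e 0 j = chi 0 j * e 0 j) -> S chi *m S e = S e.
  by move=> ech; rewrite SM; congr S; apply/rowP => j; rewrite mxE -ech.
have Pherm : (S chi)^t* = S chi.
  rewrite /S !trmxCM trmxCK mulmxA; congr (_ *m _ *m _).
  rewrite tr_diag_mx map_diag_mx; congr diag_mx.
  apply/rowP => j; rewrite /chi !mxE; exact: rmorph_nat.
exists (S chi); first split => //.
- by apply: chiM => j; rewrite mxE -natrM mulnb andbb.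
- rewrite mulmxBl mul1mx EM -/(S d) chiM ?subrr // => j; rewrite mxE.
  by have [->|_] := eqVneq; rewrite ?mulr0 ?mul1r.
move=> rho rp; have [c c0 crho] := mxpsd_le_scalar rp.
(* As [0^-1 = 0], only nonzero eigenvalues contribute, and [c'] dominates each of their inverses, so
   [P <= c' M]. *)
pose c' := \sum_i (d 0 i)^-1.
have c'0 : 0 <= c' by apply: sumr_ge0 => i _; rewrite invr_ge0.
(* The summand 1 makes the factor strictly positive even if [c] or [c'] is 0. *)
exists (c * c' + 1); first by rewrite ltr_wpDl ?mulr_ge0.
have -> : (c * c' + 1) *: M - S chi *m rho *m S chi =
   ((c * c' + 1) *: M - c *: S chi) + (S chi)^t* *m (c%:M - rho) *m S chi.
  rewrite Pherm mulmxBr mulmxBl mul_mx_scalar -scalemxAl chiM ?addrA ?subrK //.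
  by move=> j; rewrite mxE -natrM mulnb andbb.
apply: mxpsdD; last exact: mxpsd_congr.
rewrite EM -scaleNr -/(S d).
have -> : - c *: S chi = S (- c *: chi) by rewrite /S [diag_mx (_ *: _)]linearZ -scalemxAr -scalemxAl.
rewrite SL; apply/mxpsd_congr/mxpsd_diag => j.
rewrite !mxE mulNr subr_ge0; have [->|dj0] := eqVneq; rewrite ?mulr0 ?mulr1 //.
apply: le_trans (_ : c * c' * d 0 j <= _); last by rewrite ler_wpM2r // lerDl.
rewrite -mulrA ler_peMr // -[leLHS](mulVf dj0) ler_wpM2r //.
by rewrite /c' (bigD1 j) //= lerDl sumr_ge0 // => i _; rewrite invr_ge0.
Qed.

(** By positivity the kernel of [A + B] lies in that of [A]. The rank bound turns this inclusion
    into an equality, so whatever kills [A] kills [A + B], hence [B]. *)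
Lemma mxpsd_kerD n (A B K : 'M[C]_n) : mxpsd A -> mxpsd B ->
  (\rank (A + B)%R <= \rank A)%N -> K *m A = 0 -> K *m B = 0.
Proof.
move=> Ap Bp rAB KA0.
have kerE (v : 'rV_n) : v *m (A + B) = 0 -> v *m A = 0.
  move=> vAB; apply: mxpsd_form_eq0 => //.
  have : (v *m A *m v^t*) 0 0 + (v *m B *m v^t*) 0 0 = 0.
    have -> (X Y : 'M[C]_1) : X 0 0 + Y 0 0 = (X + Y) 0 0 by rewrite mxE.
    by rewrite -mulmxDl -mulmxDr vAB mul0mx mxE.
  by move/eqP; rewrite paddr_eq0 // => /andP[/eqP].
have sub : (kermx (A + B) <= kermx A)%MS.
  apply/row_subP => i; apply/sub_kermxP; apply: kerE.
  by rewrite -row_mul mulmx_ker row0.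
have eqr : \rank (kermx (A + B)) == \rank (kermx A).
  by rewrite eqn_leq mxrankS //= !mxrank_ker leq_sub2l.
have sub' : (kermx A <= kermx (A + B))%MS.
  by rewrite (mxrank_leqif_sup sub) in eqr.
have /sub_kermxP : (K <= kermx (A + B))%MS.
  by apply: submx_trans sub'; apply/sub_kermxP.
by rewrite mulmxDr KA0 add0r.
Qed.

(** The entry is a sum of eigenvalues weighted by products of two entries of a unitary matrix, each
    of modulus at most 1. This bound later dominates the series of a loop entrywise. *)
Lemma mxpsd_entry_le n (M : 'M[C]_n) i j : mxpsd M -> `|M i j| <= \tr M.
Proof.
move=> /mxpsd_spectral[U [UU UU'] [d d0 ->]].
have U1 k l : `|U k l| <= 1.
  rewrite -(@expr_le1 _ 2) // normCK.
  have <- : (U^t* *m U) l l = 1 by rewrite UU' mxE eqxx.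
  rewrite mxE (bigD1 k) //= !mxE mulrC lerDl sumr_ge0 // => m _.
  by rewrite !mxE mulrC mul_conjC_ge0.
rewrite mxtrace_mulC mulmxA UU mul1mx mxtrace_diag mul_mx_diag mxE.
apply: le_trans (ler_norm_sum _ _ _) _; apply: ler_sum => k _.
rewrite !mxE !normrM norm_conjC (ger0_norm (d0 k)) mulrAC.
by rewrite ler_piMl // mulr_ile1.
Qed.

End PsdMatrix.

(** * Operators as matrices *)

Section OpMatrix.
Variable R : realType.
Local Notation C := (R[i]).
Variable t : nat.
Implicit Types A B K rho : op R t.

Lemma op_ext A B : op_eq A B -> A = B.
Proof. by move=> AB; apply/funext => x; apply/funext => y; exact: AB. Qed.

Definition mx_of_op A : 'M[C]_#|{: bas t}| :=
  \matrix_(i, j) A (enum_val i) (enum_val j).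
Definition op_of_mx (M : 'M[C]_#|{: bas t}|) : op R t :=
  fun x y => M (enum_rank x) (enum_rank y).

Lemma mx_of_opK : cancel mx_of_op op_of_mx.
Proof. by move=> A; apply: op_ext => x y; rewrite /op_of_mx mxE !enum_rankK. Qed.

Lemma op_of_mxK : cancel op_of_mx mx_of_op.
Proof. by move=> M; apply/matrixP => i j; rewrite mxE /op_of_mx !enum_valK. Qed.

Lemma sum_enum_val (V : nmodType) (F : bas t -> V) :
  \sum_x F x = \sum_(i < #|{: bas t}|) F (enum_val i).
Proof. by rewrite (reindex _ (onW_bij _ (enum_val_bij _))). Qed.

Lemma mx_of_op1 : mx_of_op (@op1 R t) = 1%:M.
Proof.
apply/matrixP => i j; rewrite !mxE /op1 (inj_eq enum_val_inj).
by case: eqP.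
Qed.

Lemma mx_of_opD A B : mx_of_op (opD A B) = mx_of_op A + mx_of_op B.
Proof. by apply/matrixP => i j; rewrite !mxE. Qed.

Lemma mx_of_opB A B : mx_of_op (opB A B) = mx_of_op A - mx_of_op B.
Proof. by apply/matrixP => i j; rewrite !mxE. Qed.

Lemma mx_of_opZ c A : mx_of_op (opZ c A) = c *: mx_of_op A.
Proof. by apply/matrixP => i j; rewrite !mxE. Qed.

Lemma mx_of_opM A B : mx_of_op (opM A B) = mx_of_op A *m mx_of_op B.
Proof.
by apply/matrixP => i j; rewrite !mxE /opM sum_enum_val; apply: eq_bigr => k _; rewrite !mxE.
Qed.

Lemma mx_of_adj A : mx_of_op (adj A) = (mx_of_op A)^t*.
Proof. by apply/matrixP => i j; rewrite !mxE. Qed.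

Lemma mx_of_op_sum (I : finType) (F : I -> op R t) :
  mx_of_op (fun x y => \sum_i F i x y) = \sum_i mx_of_op (F i).
Proof. by apply/matrixP => i j; rewrite !mxE summxE; apply: eq_bigr => k _; rewrite mxE. Qed.

Lemma trace_mx A : trace A = \tr (mx_of_op A).
Proof. by rewrite /trace sum_enum_val; apply: eq_bigr => i _; rewrite mxE. Qed.

(** [psd] tests with column vectors and [mxpsd] with row vectors; conjugating the entries matches
    the two. *)
Lemma psd_mx A : psd A <-> mxpsd (mx_of_op A).
Proof.
have E (v : bas t -> C) :
    \sum_x \sum_y conjc (v x) * A x y * v y =
    ((\row_i (v (enum_val i))^*) *m mx_of_op A *m (\row_i (v (enum_val i))^*)^t*) 0 0.
  rewrite mxE exchange_big sum_enum_val; apply: eq_bigr => j _ /=.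
  rewrite !mxE conjCK big_distrl sum_enum_val; apply: eq_bigr => i _ /=.
  by rewrite !mxE.
split=> Ap v; last by rewrite E; apply: Ap.
have := Ap (fun x => (v 0 (enum_rank x))^*); rewrite E.
by congr (0 <= (_ *m _ *m _^t*) 0 0); apply/rowP => i; rewrite mxE enum_valK conjCK.
Qed.

End OpMatrix.

(** * Quantum operations and cylindrical extensions *)

Section QuantumOperations.
Variable R : realType.
Local Notation C := (R[i]).
Variable t : nat.
Implicit Types (A B K U P rho sigma : op R t) (f g : op R t -> op R t).

Definition kraus K rho := opM (opM K rho) (adj K).

Lemma mx_of_kraus K rho :
  mx_of_op (kraus K rho) = mx_of_op K *m mx_of_op rho *m (mx_of_op K)^t*.
Proof. by rewrite !mx_of_opM mx_of_adj. Qed.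

(** Restricted to the positive cone, where the limits defining loops are shown to exist. *)
Definition lin_on_psd f := forall (a b : C) rho sigma,
  0 <= a -> 0 <= b -> psd rho -> psd sigma ->
  f (opD (opZ a rho) (opZ b sigma)) = opD (opZ a (f rho)) (opZ b (f sigma)).

Record qop f : Prop := Qop {
  qop_psd : forall rho, psd rho -> psd (f rho);
  qop_trace : forall rho, psd rho -> trace (f rho) <= trace rho;
  qop_lin : lin_on_psd f }.

Lemma psd_opD A B : psd A -> psd B -> psd (opD A B).
Proof. by rewrite !psd_mx mx_of_opD; apply: mxpsdD. Qed.

Lemma psd_opZ c A : 0 <= c -> psd A -> psd (opZ c A).
Proof. by rewrite !psd_mx mx_of_opZ; apply: mxpsdZ. Qed.

Lemma psd_sum (I : finType) (F : I -> op R t) :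
  (forall i, psd (F i)) -> psd (fun x y => \sum_i F i x y).
Proof.
move=> Fp; apply/psd_mx; rewrite mx_of_op_sum.
elim/big_ind: _ => [v|x y|i _]; [|exact: mxpsdD|exact/psd_mx].
by rewrite mulmx0 mul0mx mxE.
Qed.

Lemma psd_trace_ge0 A : psd A -> 0 <= trace A.
Proof.
move/psd_mx => Ap; rewrite trace_mx sumr_ge0 // => i _.
by have := Ap (delta_mx 0 i); rewrite mx_delta_form.
Qed.

Lemma trace_opD A B : trace (opD A B) = trace A + trace B.
Proof. by rewrite /trace -big_split. Qed.

Lemma trace_opZ c A : trace (opZ c A) = c * trace A.
Proof. by rewrite /trace mulr_sumr. Qed.

Lemma trace_sum (I : finType) (F : I -> op R t) :
  trace (fun x y => \sum_i F i x y) = \sum_i trace (F i).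
Proof. by rewrite /trace exchange_big. Qed.

Lemma trace_kraus K rho : trace (kraus K rho) = trace (opM (opM (adj K) K) rho).
Proof.
by rewrite !trace_mx mx_of_kraus !mx_of_opM mx_of_adj mxtrace_mulC mulmxA.
Qed.

Lemma psd_kraus K rho : psd rho -> psd (kraus K rho).
Proof.
rewrite !psd_mx mx_of_kraus => rp.
by have := @mxpsd_congr _ _ _ _ ((mx_of_op K)^t*) rp; rewrite trmxCK.
Qed.

Lemma lin_kraus K : lin_on_psd (kraus K).
Proof.
move=> a b rho sigma _ _ _ _; apply: (can_inj (@mx_of_opK R t)).
rewrite mx_of_opD !mx_of_opZ !mx_of_kraus mx_of_opD !mx_of_opZ.
by rewrite mulmxDr mulmxDl -!(scalemxAr, scalemxAl).
Qed.

Lemma qop_id : qop id. Proof. by split. Qed.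

Lemma qop_comp f g : qop f -> qop g -> qop (fun rho => g (f rho)).
Proof.
move=> [fp ft fl] [gp gt gl]; split=> [rho rp|rho rp|a b rho sigma a0 b0 rp sp].
- exact/gp/fp.
- exact: le_trans (gt _ (fp _ rp)) (ft _ rp).
- by rewrite fl // gl //; apply: fp.
Qed.

(** The completeness relation gives trace preservation: by cyclicity the trace of the image is that
    of the sum of all [adj (K i)] times [K i], applied to [rho]. *)
Lemma qop_kraus_sum (I : finType) (K : I -> op R t) :
  (forall x y, \sum_i opM (adj (K i)) (K i) x y = op1 R x y) ->
  qop (fun rho x y => \sum_i kraus (K i) rho x y).
Proof.
move=> K1; split=> [rho rp|rho rp|a b rho sigma a0 b0 rp sp].
- by apply: psd_sum => i; apply: psd_kraus.
- rewrite trace_sum (eq_bigr _ (fun i _ => trace_kraus (K i) rho)).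
  rewrite -trace_sum le_eqVlt; apply/orP; left; apply/eqP.
  congr trace; apply: op_ext => x y; rewrite exchange_big /=.
  under eq_bigr do rewrite -mulr_suml K1.
  rewrite (bigD1 x) //= /op1 eqxx mul1r big1 ?addr0 // => z zx.
  by rewrite eq_sym (negbTE zx) mul0r.
- apply: op_ext => x y; rewrite /opD /opZ !mulr_sumr -big_split; apply: eq_bigr => i _ /=.
  by rewrite -/(opZ a rho) -/(opZ b sigma) -/(opD _ _) lin_kraus.
Qed.

Lemma qop_unitary U : unitary U -> qop (kraus U).
Proof.
move=> /op_ext Uu; split; [exact: psd_kraus|move=> rho _|exact: lin_kraus].
by rewrite trace_kraus Uu !trace_mx mx_of_opM mx_of_op1 mul1mx.
Qed.

Lemma projector_ortho P : projector P -> projector (Defs.ortho P).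
Proof.
move=> [/op_ext Pa /op_ext PP].
have Pa' : (mx_of_op P)^t* = mx_of_op P by rewrite -mx_of_adj Pa.
have PP' : mx_of_op P *m mx_of_op P = mx_of_op P by rewrite -mx_of_opM PP.
suff [Qa QQ] : adj (Defs.ortho P) = Defs.ortho P /\ opM (Defs.ortho P) (Defs.ortho P) = Defs.ortho P.
  by split=> x y; rewrite ?Qa ?QQ.
split; apply: (can_inj (@mx_of_opK R t)).
  rewrite mx_of_adj mx_of_opB mx_of_op1 linearB /= map_mxB Pa'.
  by rewrite trmx1 map_mx1.
rewrite mx_of_opM mx_of_opB mx_of_op1 mulmxBl !mulmxBr mul1mx mulmx1 PP'.
by rewrite mul1mx subrr subr0.
Qed.

(** Conservation of probability over the two outcomes of a measurement; it controls the trace for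
    both [If] and [While]. *)
Lemma trace_kraus_ortho P rho : projector P ->
  trace (kraus P rho) + trace (kraus (Defs.ortho P) rho) = trace rho.
Proof.
move=> Pp; have [/op_ext Qa /op_ext QQ] := projector_ortho Pp.
have [/op_ext Pa /op_ext PP] := Pp.
rewrite !trace_kraus Pa PP Qa QQ !trace_mx !mx_of_opM -mxtraceD -mulmxDl.
by rewrite mx_of_opB mx_of_op1 addrC subrK mul1mx.
Qed.

End QuantumOperations.

(** * Cylindrical extensions *)

Section Cylinder.
Variables (R : realType) (n : nat).
Local Notation C := (R[i]).
Implicit Types (qs : seq 'I_n).

(** Overwrites [x] by [w] on the register. Off the register [index v qs] equals [size qs], so
    [insub] returns [None] and [x v] is kept. *)
Definition extend qs (x : bas n) (w : bas (size qs)) : bas n :=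
  [ffun v => if insub (index v qs) is Some i then w i else x v].

Definition agree_off qs (x y : bas n) :=
  [forall v : 'I_n, (v \notin qs) ==> (x v == y v)].

Lemma agree_offP qs (x y : bas n) :
  reflect (forall v, v \notin qs -> x v = y v) (agree_off qs x y).
Proof.
apply: (iffP forallP) => [h v vq|h v]; first by have /implyP/(_ vq)/eqP := h v.
by apply/implyP => vq; apply/eqP/h.
Qed.

Lemma restr_extend qs x w : uniq qs -> restr qs (extend x w) = w.
Proof.
move=> uq; apply/ffunP => i; rewrite !ffunE (tnth_nth (tnth (in_tuple qs) i)) /=.
by rewrite index_uniq // valK.
Qed.

Lemma extend_off qs x (w : bas (size qs)) v : v \notin qs -> extend x w v = x v.
Proof. by rewrite -index_mem ffunE => vq; rewrite insubN. Qed.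

Lemma extend_restr qs x y : agree_off qs x y -> extend x (restr qs y) = y.
Proof.
move=> /agree_offP xy; apply/ffunP => v.
have [vq|vq] := boolP (v \in qs); last by rewrite extend_off ?xy.
rewrite ffunE; have := vq; rewrite -index_mem => iq; rewrite insubT ffunE.
by rewrite (tnth_nth v) /= nth_index.
Qed.

Lemma cylE qs (A : op R (size qs)) x y :
  cyl A x y = A (restr qs x) (restr qs y) * (agree_off qs x y)%:R.
Proof. by rewrite /cyl -/(agree_off qs x y); case: agree_off. Qed.

Lemma agree_offC qs x y : agree_off qs x y = agree_off qs y x.
Proof. by apply/agree_offP/agree_offP => h v /h. Qed.

Lemma agree_off_refl qs x : agree_off qs x x.
Proof. exact/agree_offP. Qed.

Lemma agree_off_trans qs y x z :
  agree_off qs x y -> agree_off qs y z -> agree_off qs x z.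
Proof. by move=> /agree_offP h /agree_offP h'; apply/agree_offP => v vq; rewrite h ?h'. Qed.

Lemma agree_off_extend qs x (w : bas (size qs)) : agree_off qs x (extend x w).
Proof. by apply/agree_offP => v vq; rewrite extend_off. Qed.

Lemma adj_cyl qs (A : op R (size qs)) : adj (cyl A) = cyl (adj A).
Proof.
apply: op_ext => x y; rewrite /adj !cylE agree_offC rmorphM /=.
by congr (_ * _); apply: rmorph_nat.
Qed.

(** Only those [z] that agree with [x] off the register contribute to the product. They are the
    [extend x w], so the sum becomes one over the basis of the register. *)
Lemma cylM qs (A B : op R (size qs)) : uniq qs ->
  opM (cyl A) (cyl B) = cyl (opM A B).
Proof.
move=> uq; apply: op_ext => x y; rewrite cylE /opM.
rewrite (bigID (agree_off qs x)) /= [X in _ + X]big1 ?addr0; last first.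
  by move=> z /negbTE xz; rewrite cylE xz mulr0 mul0r.
rewrite (reindex (@extend qs x)) /=; last first.
  exists (restr qs) => z; first by rewrite restr_extend.
  exact: extend_restr.
rewrite big_distrl /=; apply: eq_big => [w|w _]; first by rewrite agree_off_extend.
rewrite !cylE restr_extend // agree_off_extend mulr1 mulrA; congr (_ * _%:R).
congr nat_of_bool; apply/idP/idP; apply: agree_off_trans.
  exact: agree_off_extend.
by rewrite agree_offC agree_off_extend.
Qed.

Lemma cyl1 qs : cyl (@op1 R (size qs)) = @op1 R n.
Proof.
apply: op_ext => x y; rewrite cylE /op1; have [->|xy] := eqVneq x y.
  by rewrite eqxx agree_off_refl mulr1.
case: eqP => [rxy|_]; last by rewrite mul0r.
case: (boolP (agree_off qs x y)) => [/extend_restr|_]; last by rewrite mulr0.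
rewrite -rxy => e; case/eqP: xy; rewrite -e; symmetry.
exact/extend_restr/agree_off_refl.
Qed.

Lemma cylB qs (A B : op R (size qs)) : cyl (opB A B) = opB (cyl A) (cyl B).
Proof. by apply: op_ext => x y; rewrite /opB !cylE mulrBl. Qed.

Lemma cyl_ortho qs (P : op R (size qs)) : cyl (Defs.ortho P) = Defs.ortho (cyl P).
Proof. by rewrite /Defs.ortho cylB cyl1. Qed.

Lemma projector_cyl qs (P : op R (size qs)) : uniq qs -> projector P ->
  projector (cyl P).
Proof.
by move=> uq [/op_ext Pa /op_ext PP]; split=> x y; rewrite ?adj_cyl ?Pa ?cylM ?PP.
Qed.

Lemma unitary_cyl qs (U : op R (size qs)) : uniq qs -> unitary U -> unitary (cyl U).
Proof. by move=> uq /op_ext Uu x y; rewrite adj_cyl cylM ?Uu ?cyl1. Qed.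

Lemma sem_assertE qs (P : op R (size qs)) : projector P ->
  sem_assert P = kraus (cyl P).
Proof. by move=> [/op_ext Pa _]; apply/funext => rho; rewrite /kraus adj_cyl Pa. Qed.

(** On the register, the operators [|i><0|0><i|] are the basis projectors, which sum to the
    identity. *)
Lemma init_complete qs x y : uniq qs ->
  \sum_(i : bas (size qs)) opM (adj (cyl (ket0bra R i))) (cyl (ket0bra R i)) x y
  = op1 R x y.
Proof.
move=> uq; rewrite -(cyl1 qs).
under eq_bigr do rewrite adj_cyl cylM // cylE.
rewrite -mulr_suml cylE; congr (_ * _); rewrite /op1.
set u := restr qs x; set v := restr qs y.
have E i : opM (adj (ket0bra R i)) (ket0bra R i) u v = ((u == i) && (v == i))%:R.
  rewrite /opM /adj /ket0bra (bigD1 [ffun=> false]) //= eqxx /=.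
  rewrite big1 ?addr0 => [|z /negbTE ->]; last by rewrite mulr0.
  by case: eqP; case: eqP; rewrite ?conjc1 ?conjc0 ?(mulr1, mul0r, mulr0).
under eq_bigr do rewrite E.
rewrite (bigD1 u) //= eqxx /= big1 ?addr0 => [|z zu].
  by rewrite eq_sym; case: eqP.
by rewrite eq_sym (negbTE zu).
Qed.

End Cylinder.

(** * Limits and loops *)

Section ComplexLimits.
Local Open Scope classical_set_scope.
Variable R : realType.
Local Notation C := (R[i]).
Local Notation Re := complex.Re.
Local Notation Im := complex.Im.
Implicit Types (u v : nat -> C) (l m c : C).

(** Componentwise, to match [climn], which takes the limits of real and imaginary parts
    separately. *)
Definition ctends u l :=
  ((fun k => Re (u k)) @ \oo --> Re l) /\ ((fun k => Im (u k)) @ \oo --> Im l).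

Lemma climnE u l : ctends u l -> climn u = l.
Proof.
move=> [ur ui]; rewrite /climn (cvg_lim _ ur) // (cvg_lim _ ui) //.
by case: l {ur ui}.
Qed.

Lemma ReD (x y : C) : Re (x + y) = Re x + Re y. Proof. by case: x; case: y. Qed.
Lemma ImD (x y : C) : Im (x + y) = Im x + Im y. Proof. by case: x; case: y. Qed.
Lemma ReM (x y : C) : Re (x * y) = Re x * Re y - Im x * Im y.
Proof. by case: x; case: y. Qed.
Lemma ImM (x y : C) : Im (x * y) = Re x * Im y + Im x * Re y.
Proof. by case: x => a b; case: y => c d /=. Qed.

Lemma ctends_cst c : ctends (fun=> c) c.
Proof. by split; apply: cvg_cst. Qed.

Lemma ctendsD u v l m : ctends u l -> ctends v m ->
  ctends (fun k => u k + v k) (l + m).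
Proof.
move=> [ur ui] [vr vi]; split.
  by under eq_fun do rewrite ReD; rewrite ReD; apply: cvgD.
by under eq_fun do rewrite ImD; rewrite ImD; apply: cvgD.
Qed.

Lemma ctendsMl c u l : ctends u l -> ctends (fun k => c * u k) (c * l).
Proof.
move=> [ur ui]; split.
  under eq_fun do rewrite ReM; rewrite ReM.
  by apply: cvgB; apply: cvgM => //; apply: cvg_cst.
under eq_fun do rewrite ImM; rewrite ImM.
by apply: cvgD; apply: cvgM => //; apply: cvg_cst.
Qed.

Lemma ctends_sum (I : finType) (u : I -> nat -> C) (l : I -> C) :
  (forall i, ctends (u i) (l i)) ->
  ctends (fun k => \sum_i u i k) (\sum_i l i).
Proof.
move=> ul.
elim: (index_enum I) => [|i s IH].
  by under eq_fun do rewrite big_nil; rewrite big_nil; apply: ctends_cst.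
under eq_fun do rewrite big_cons; rewrite big_cons.
exact: ctendsD.
Qed.

Lemma ctends_le u l c : ctends u l -> (forall k, u k <= c) -> l <= c.
Proof.
move=> [ur ui] uc.
(* Comparable complex numbers have equal imaginary parts, so that of [u] is constant. *)
have imE k : Im (u k) = Im c by have := uc k; rewrite lecE => /andP[/eqP <-].
rewrite lecE eq_le; apply/andP; split; [apply/andP; split|].
- by apply: (cvgr_to_ge ui); apply: nearW => k; rewrite imE.
- by apply: (cvgr_to_le ui); apply: nearW => k; rewrite imE.
- by apply: (cvgr_to_le ur); apply: nearW => k; have := uc k; rewrite lecE => /andP[].
Qed.

Lemma dominated_sum_cvg (a b : nat -> R) (T : R) :
  (forall k, `|a k| <= b k) -> (forall N, \sum_(k < N) b k <= T) ->
  cvgn (fun N => \sum_(k < N) a k).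
Proof.
move=> ab bT.
have -> : (fun N => \sum_(k < N) a k) = series a.
  by apply/funext => N; rewrite /series /= big_mkord.
apply: normed_cvg; apply: nondecreasing_is_cvgn.
  by apply/nondecreasing_seqP => N; rewrite /= !seriesEord /= big_ord_recr /= lerDl normr_ge0.
exists T => _ [N _ <-]; apply: le_trans (bT N).
by rewrite /= seriesEord /=; apply: ler_sum => k _; apply: ab.
Qed.

Lemma Re_sum N (u : 'I_N -> C) : Re (\sum_k u k) = \sum_k Re (u k).
Proof. by elim/big_ind2: _ => // x a y b <- <-; rewrite ReD. Qed.

Lemma Im_sum N (u : 'I_N -> C) : Im (\sum_k u k) = \sum_k Im (u k).
Proof. by elim/big_ind2: _ => // x a y b <- <-; rewrite ImD. Qed.

Lemma normc_ge_Im (z : C) : `|Im z|%:C%C <= `|z|.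
Proof.
have := normc_ge_Re (z * 'i%C); rewrite ReiNIm normrN normrM => h.
by apply: le_trans h _; rewrite complexiE normCi mulr1.
Qed.

Lemma dominated_csum (u d : nat -> C) (T : C) :
  (forall k, `|u k| <= d k) -> (forall N, \sum_(k < N) d k <= T) ->
  exists l, ctends (fun N => \sum_(k < N) u k) l.
Proof.
move=> ud dT.
have bT N : \sum_(k < N) Re (d k) <= Re T.
  by have := dT N; rewrite lecE Re_sum => /andP[].
have lerR (x : R) (z : C) : x%:C%C <= z -> x <= Re z by rewrite lecE => /andP[].
have cr k : `|Re (u k)| <= Re (d k).
  by apply: lerR; exact: le_trans (normc_ge_Re _) (ud k).
have ci k : `|Im (u k)| <= Re (d k).
  by apply: lerR; exact: le_trans (normc_ge_Im _) (ud k).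
exists (Complex (limn (fun N => \sum_(k < N) Re (u k))) (limn (fun N => \sum_(k < N) Im (u k)))).
by split; [under eq_fun do rewrite Re_sum; exact: (dominated_sum_cvg cr bT)
  | under eq_fun do rewrite Im_sum; exact: (dominated_sum_cvg ci bT)].
Qed.

End ComplexLimits.

(** * Loops as limits of partial sums *)

Section While.
Variable R : realType.
Local Notation C := (R[i]).
Variable t : nat.
Implicit Types (rho sigma : op R t) (E Q g : op R t -> op R t).

Lemma psd_entry_le rho x y : psd rho -> `|rho x y| <= trace rho.
Proof.
move=> /psd_mx/mxpsd_entry_le - /(_ (enum_rank x) (enum_rank y)).
by rewrite mxE !enum_rankK trace_mx.
Qed.

Lemma psd_lim (M : nat -> op R t) (L : op R t) :
  (forall x y, ctends (fun k => M k x y) (L x y)) ->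
  (forall k, psd (M k)) -> psd L.
Proof.
(* [ctends_le] bounds limits from above, hence the passage to the negated form. *)
move=> ML Mp v; rewrite -oppr_le0 -mulN1r.
apply: (@ctends_le _ (fun k => -1 * \sum_x \sum_y conjc (v x) * M k x y * v y)).
  apply: ctendsMl; apply: ctends_sum => x; apply: ctends_sum => y.
  rewrite mulrAC; under eq_fun do rewrite mulrAC.
  exact: ctendsMl.
by move=> k; rewrite mulN1r oppr_le0; apply: Mp.
Qed.

Lemma trace_lim_le (M : nat -> op R t) (L : op R t) (c : C) :
  (forall x y, ctends (fun k => M k x y) (L x y)) ->
  (forall k, trace (M k) <= c) -> trace L <= c.
Proof.
move=> ML Mc; apply: (@ctends_le _ (fun k => trace (M k))) => //.
by apply: ctends_sum => x; apply: ML.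
Qed.

(** The loop clause of [sem] with [E] the branch entering the body, [Q] the exit branch and [g] the
    body. *)
Definition while_op E Q g rho : op R t :=
  fun x y => climn (fun N => \sum_(k < N) Q (iter k (fun r => g (E r)) rho) x y).

Section WhileOp.
Variables (E Q g : op R t -> op R t).
Hypotheses (Ep : forall rho, psd rho -> psd (E rho))
           (Qp : forall rho, psd rho -> psd (Q rho))
           (El : lin_on_psd E) (Ql : lin_on_psd Q)
           (EQ : forall rho, trace (E rho) + trace (Q rho) = trace rho)
           (gq : qop g).

Local Notation body := (fun r => g (E r)).
Local Notation part rho N := (fun x y => \sum_(k < N) Q (iter k body rho) x y).

Lemma psd_iter_body k rho : psd rho -> psd (iter k body rho).
Proof. by move=> rp; elim: k => //= k IH; apply/(qop_psd gq)/Ep. Qed.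

Lemma trace_part N rho : psd rho -> trace (part rho N) <= trace rho.
Proof.
move=> rp; rewrite trace_sum.
(* Invariant: the trace that has left the loop plus the trace still inside never exceeds the initial
   one. *)
suff : \sum_(k < N) trace (Q (iter k body rho)) + trace (iter N body rho) <= trace rho.
  by apply: le_trans; rewrite lerDl psd_trace_ge0 //; apply: psd_iter_body.
elim: N => [|N IH]; first by rewrite big_ord0 add0r.
rewrite big_ord_recr /= -addrA; apply: le_trans IH; rewrite lerD2l.
rewrite -[leRHS]EQ addrC lerD2r; apply: (qop_trace gq).
exact/Ep/psd_iter_body.
Qed.

(** Each entry of a summand is dominated by its trace, and [trace_part] bounds the sums of these
    traces, so the series converges absolutely. *)
Lemma while_op_ctends rho : psd rho -> forall x y,
  ctends (fun N => part rho N x y) (while_op E Q g rho x y).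
Proof.
move=> rp x y.
have [l ul] : exists l, ctends (fun N => part rho N x y) l.
  apply: (@dominated_csum _ (fun k => Q (iter k body rho) x y) (fun k => trace (Q (iter k body rho))) (trace rho)).
    by move=> k; apply: psd_entry_le; apply/Qp/psd_iter_body.
  by move=> N; rewrite -trace_sum; apply: trace_part.
by rewrite /while_op (climnE ul).
Qed.

Lemma lin_iter_body k : lin_on_psd (iter k body).
Proof.
move=> a b rho sigma a0 b0 rp sp; elim: k => //= k ->.
by rewrite El ?(qop_lin gq) //; do ?apply: Ep; exact: psd_iter_body.
Qed.

Lemma qop_while : qop (while_op E Q g).
Proof.
split=> [rho rp|rho rp|a b rho sigma a0 b0 rp sp].
- apply: (psd_lim (while_op_ctends rp)) => N.
  by apply: psd_sum => k; apply/Qp/psd_iter_body.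
- by apply: (trace_lim_le (while_op_ctends rp)) => N; apply: trace_part.
- apply: op_ext => x y; rewrite /while_op; apply: climnE.
  have := ctendsD (ctendsMl a (while_op_ctends rp x y)) (ctendsMl b (while_op_ctends sp x y)).
  congr ctends; apply/funext => N; rewrite !mulr_sumr -big_split.
  apply: eq_bigr => k _ /=; rewrite lin_iter_body // Ql //; exact: psd_iter_body.
Qed.

End WhileOp.
End While.

(** * Programs as quantum operations *)

Section Semantics.
Variables (R : realType) (n : nat).

Lemma qop_if (E Q f g : op R n -> op R n) :
  (forall rho, psd rho -> psd (E rho)) -> (forall rho, psd rho -> psd (Q rho)) ->
  lin_on_psd E -> lin_on_psd Q ->
  (forall rho, trace (E rho) + trace (Q rho) = trace rho) ->
  qop f -> qop g -> qop (fun rho => opD (f (E rho)) (g (Q rho))).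
Proof.
move=> Ep Qp El Ql EQ fq gq; split=> [rho rp|rho rp|a b rho sigma a0 b0 rp sp].
- by apply: psd_opD; [apply/(qop_psd fq)/Ep | apply/(qop_psd gq)/Qp].
- rewrite trace_opD -[leRHS]EQ lerD //.
    exact/(qop_trace fq)/Ep.
  exact/(qop_trace gq)/Qp.
- rewrite El // Ql // (qop_lin fq) ?(qop_lin gq) //; try (by apply: Ep); try (by apply: Qp).
  by apply: op_ext => x y; rewrite /opD /opZ !mulrDr addrACA.
Qed.

Lemma qop_kraus_le (K K' : op R n) :
  (forall rho, trace (kraus K rho) + trace (kraus K' rho) = trace rho) -> qop (kraus K).
Proof.
move=> KK; split; [exact: psd_kraus|move=> rho rp|exact: lin_kraus].
by rewrite -[leRHS]KK lerDl psd_trace_ge0 //; apply: psd_kraus.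
Qed.

Lemma qop_sem (S : prog R n) : wf S -> qop (sem S).
Proof.
elim: S => [|qs|qs U|qs P|S0 IH0 S1 IH1|qs P S1 IH1 S0 IH0|qs P S IH] /=.
- by move=> _; apply: qop_id.
- move=> /andP[_ uq]; apply: (@qop_kraus_sum _ _ _ (fun i : bas (size qs) => cyl (ket0bra R i))).
  by move=> x y; apply: init_complete.
- by move=> [/andP[_ uq] Uu]; apply/qop_unitary/unitary_cyl.
- move=> [/andP[_ uq] Pp]; rewrite sem_assertE //.
  by apply: qop_kraus_le => rho; apply/trace_kraus_ortho/projector_cyl.
- by move=> [w0 w1]; apply: qop_comp; [exact: IH0|exact: IH1].
- move=> [/andP[_ uq] Pp w1 w0]; rewrite !sem_assertE //; last exact: projector_ortho.
  apply: qop_if; try exact: psd_kraus; try exact: lin_kraus; [|exact: IH1|exact: IH0].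
  by move=> rho; rewrite cyl_ortho; apply/trace_kraus_ortho/projector_cyl.
- move=> [/andP[_ uq] Pp w]; rewrite !sem_assertE //; last exact: projector_ortho.
  apply: qop_while; try exact: psd_kraus; try exact: lin_kraus; [|exact: IH].
  by move=> rho; rewrite cyl_ortho; apply/trace_kraus_ortho/projector_cyl.
Qed.

Lemma pdo_sem (S : prog R n) rho : wf S -> pdo rho -> pdo (sem S rho).
Proof.
move=> /qop_sem Sq [rp rt]; split; first exact: (qop_psd Sq).
exact: le_trans (qop_trace Sq rp) rt.
Qed.

End Semantics.

(** * Faces and completeness *)

Definition combine2 (R : realType) t (x y : R) (rho sigma : op R t) : op R t :=
  opD (opZ x%:C%C rho) (opZ y%:C%C sigma).

Section Faces.
Variable R : realType.
Local Notation C := (R[i]).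
Variable t : nat.
Implicit Types (rho sigma P : op R t) (G : op R t -> Prop).

(** Right to left this is convexity, left to right extremality. The weights need not sum to 1, as in
    the two-term case of [ws_conv]. *)
Definition face G := forall (x y : R) rho sigma, 0 < x -> 0 < y ->
  pdo rho -> pdo sigma -> pdo (combine2 x y rho sigma) ->
  (G (combine2 x y rho sigma) <-> G rho /\ G sigma).

Lemma mx_of_combine2 (x y : R) rho sigma :
  mx_of_op (combine2 x y rho sigma) =
  x%:C%C *: mx_of_op rho + y%:C%C *: mx_of_op sigma.
Proof. by rewrite mx_of_opD !mx_of_opZ. Qed.

Lemma pdo_half rho sigma : pdo rho -> pdo sigma ->
  pdo (combine2 2^-1 2^-1 rho sigma).
Proof.
move=> [rp rt] [sp st]; split.
  by apply: psd_opD; apply: psd_opZ; rewrite ?ler0c ?invr_ge0.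
rewrite trace_opD !trace_opZ -mulrDr fmorphV rmorph_nat.
by rewrite mulrC ler_pdivrMr // mul1r -natr1 lerD.
Qed.

Lemma pdo_kraus P rho : projector P -> pdo rho -> pdo (kraus P rho).
Proof.
move=> Pp [rp rt]; split; first exact: psd_kraus.
apply: le_trans rt; rewrite -(trace_kraus_ortho rho Pp) lerDl.
exact/psd_trace_ge0/psd_kraus.
Qed.

(* [P] projects onto the support of a member of [G] of maximal rank. *)
Lemma face_projector G : face G -> (forall rho, G rho -> pdo rho) ->
  (exists rho, G rho) ->
  exists P, [/\ projector P, forall rho, pdo rho -> G (kraus P rho) &
                forall rho, G rho -> kraus P rho = rho].
Proof.
move=> Gf Gpdo [rho0 G0].
pose rk r := `[< exists2 rho, G rho & \rank (mx_of_op rho) = r >].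
have ex_rk : exists r, rk r.
  by exists (\rank (mx_of_op rho0)); apply/asboolP; exists rho0.
have rk_le r : rk r -> (r <= #|{: bas t}|)%N.
  by move=> /asboolP[rho _ <-]; apply: rank_leq_row.
case: (ex_maxnP ex_rk rk_le) => _ /asboolP[sigma Gs <-] smax.
have [sp st] := Gpdo _ Gs; have sm := (psd_mx sigma).1 sp.
have [Pm [Ph PP Ps] Pdom] := mxpsd_support sm.
exists (op_of_mx Pm).
have Pp : projector (op_of_mx Pm).
  suff [Pa PP'] : adj (op_of_mx Pm) = op_of_mx Pm /\
      opM (op_of_mx Pm) (op_of_mx Pm) = op_of_mx Pm by split=> x y; rewrite ?Pa ?PP'.
  by split; apply: (can_inj (@mx_of_opK R t)); rewrite ?mx_of_adj ?mx_of_opM op_of_mxK.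
split=> // [rho rpdo|rho Gr].
- have [k k0 kp] := Pdom _ ((psd_mx rho).1 rpdo.1).
  have pi_pdo := pdo_kraus Pp rpdo.
  set pi := kraus _ rho in pi_pdo *.
  have pim : mx_of_op pi = Pm *m mx_of_op rho *m Pm by rewrite mx_of_kraus op_of_mxK Ph.
  (* The weights of a face are real, while [k] is a positive element of [C]. *)
  have kE : k = (complex.Re k)%:C%C by rewrite RRe_real // gtr0_real.
  have Rk0 : 0 < complex.Re k by move: k0; rewrite ltcE => /andP[].
  (* By the choice of [k] the remainder [tau] is positive, so [sigma] is a positive combination of
     [pi] and [tau], and extremality puts [pi] in [G]. *)
  pose tau := opD sigma (opZ (- k^-1) pi).
  have tau_pdo : pdo tau.
    split; last first.
      rewrite trace_opD trace_opZ mulNr; apply: le_trans st.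
      by rewrite gerBl mulr_ge0 ?psd_trace_ge0 ?invr_ge0 ?(ltW k0) //; exact: pi_pdo.1.
    apply/psd_mx; rewrite mx_of_opD mx_of_opZ pim.
    have -> : mx_of_op sigma + - k^-1 *: (Pm *m mx_of_op rho *m Pm) =
        k^-1 *: (k *: mx_of_op sigma - Pm *m mx_of_op rho *m Pm).
      by rewrite scalerBr scalerA mulVf ?gt_eqF // scale1r scaleNr.
    by apply: mxpsdZ; rewrite ?invr_ge0 ?ltW.
  have sE : sigma = combine2 (complex.Re k)^-1 1 pi tau.
    apply: op_ext => x y; rewrite /combine2 /tau /opD /opZ fmorphV rmorph1 /= -kE mul1r.
    by rewrite mulNr addrCA subrr addr0.
  have := Gf (complex.Re k)^-1 1 pi tau; rewrite -sE => /(_ _ _ pi_pdo tau_pdo (Gpdo _ Gs)).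
  by rewrite invr_gt0 Rk0 ltr01 => /(_ isT isT) [/(_ Gs)[]].
- have [rp rt] := Gpdo _ Gr; have rm := (psd_mx rho).1 rp.
  (* By convexity the midpoint lies in [G], so its rank is at most that of [sigma]; [mxpsd_kerD]
     then shows that [rho] is killed off the support of [sigma]. *)
  have Gh : G (combine2 2^-1 2^-1 sigma rho).
    by apply/Gf; rewrite ?invr_gt0 //; try (by apply: Gpdo); apply: pdo_half; apply: Gpdo.
  set h : C := (2^-1)%:C%C.
  have h0 : 0 < h by rewrite ltcR invr_gt0.
  have kill : (1%:M - Pm) *m mx_of_op rho = 0.
    have : (1%:M - Pm) *m (h *: mx_of_op rho) = 0.
      apply: (@mxpsd_kerD _ _ (h *: mx_of_op sigma)).
      - by apply: mxpsdZ => //; apply: ltW.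
      - by apply: mxpsdZ => //; apply: ltW.
      - rewrite -mx_of_combine2 mxrank_scale_nz ?gt_eqF //.
        by apply: smax; apply/asboolP; exists (combine2 2^-1 2^-1 sigma rho).
      - by rewrite -scalemxAr Ps scaler0.
    by rewrite -scalemxAr => /eqP; rewrite scaler_eq0 gt_eqF //= => /eqP.
  have Pr : Pm *m mx_of_op rho = mx_of_op rho.
    by move: kill => /eqP; rewrite mulmxBl mul1mx subr_eq0 => /eqP <-.
  apply: (can_inj (@mx_of_opK R t)); rewrite mx_of_kraus op_of_mxK Pr.
  by rewrite -{1}(mxpsd_herm rm) -trmxCM Pr mxpsd_herm.
Qed.

End Faces.

(** * Assertions on the full register *)

Section FullRegister.
Variables (R : realType) (n : nat).
Implicit Types P : op R n.
Local Notation qs := (enum 'I_n).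

(** Transports [P] to the index type of the register of all variables. The base point of [extend] is
    overwritten everywhere. *)
Definition full_op P : op R (size qs) :=
  fun u v => P (extend [ffun => false] u) (extend [ffun => false] v).

Lemma agree_off_full (x y : bas n) : agree_off qs x y.
Proof. by apply/agree_offP => v; rewrite mem_enum. Qed.

Lemma cyl_full P : cyl (full_op P) = P.
Proof.
apply: op_ext => x y; rewrite cylE agree_off_full mulr1 /full_op.
by rewrite !extend_restr ?agree_off_full.
Qed.

Lemma projector_full P : projector P -> projector (full_op P).
Proof.
move=> [Pa PP]; split=> u v; first exact: Pa.
rewrite -[RHS]PP /opM [RHS](reindex (@extend _ qs [ffun => false])) //.
exists (restr qs) => z _; first by rewrite restr_extend ?enum_uniq.
by rewrite extend_restr ?agree_off_full.
Qed.

Lemma wf_assert_full P : (0 < n)%N -> projector P -> wf (Assert (full_op P)).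
Proof.
move=> n0 Pp; split; last exact: projector_full.
by rewrite /wf_reg enum_uniq size_enum_ord n0.
Qed.

Lemma sem_assert_full P : projector P -> sem (Assert (full_op P)) = kraus P.
Proof. by move=> Pp; rewrite /= sem_assertE ?cyl_full //; apply: projector_full. Qed.

End FullRegister.

Lemma wf_reg_qubitless n (qs : seq 'I_n) : n = 0%N -> wf_reg qs -> False.
Proof. by move=> n0; subst n; case: qs => [|[]]. Qed.

(** Registers of well-formed programs are nonempty, so only [Skip] and [Seq] remain. *)
Lemma sem_qubitless (R : realType) n (S : prog R n) : n = 0%N -> wf S ->
  forall rho, sem S rho = rho.
Proof.
move=> n0; have no qs := @wf_reg_qubitless n qs n0.
elim: S => [|qs|qs U|qs P|S0 IH0 S1 IH1|qs P S1 IH1 S0 IH0|qs P S IH] //=.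
- by move=> /no.
- by move=> [/no].
- by move=> [/no].
- by move=> [w0 w1] rho; rewrite IH0 ?IH1.
- by move=> [/no].
- by move=> [/no].
Qed.

(** * Completeness of the abstract interpretation *)

Section Completeness.
Variables (R : realType) (n : nat) (A : Type).
Variables (sat : op R n -> A -> Prop) (meet join : (A -> Prop) -> A).
Variable IN : in_schemas R n A.
Hypotheses (ws : well_structured sat meet join)
           (IN_sound : sound sat meet IN) (IN_complete : rel_complete sat meet IN).
Implicit Types (S T : prog R n) (a b c : A) (Q : op R n -> Prop).
Local Notation ale := (ale sat).
Local Notation alpha := (alpha sat meet).

(** [valid S a a'] unfolds to [ale a' (spost S a)], so [spost S a] is itself a valid
    postcondition. *)
Definition spost S a :=
  meet (fun b => forall rho, pdo rho -> sat rho a -> sat (sem S rho) b).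

Lemma sem_sharpE S a : wf S -> sem_sharp sat join IN S a = spost S a.
Proof.
move=> wS; apply: (ws_antisym ws).
  by apply: (ws_join_lub ws) => a' /(IN_sound wS).
by apply: (ws_join_ub ws); apply: IN_complete.
Qed.

Lemma alpha_sat Q rho : (forall sigma, Q sigma -> pdo sigma) ->
  Q rho -> sat rho (alpha Q).
Proof.
by move=> Qp Qr; apply: (ws_meet_sat ws) => [|b /(_ _ Qr)[]//]; apply: Qp.
Qed.

Lemma alpha_lb Q b : (forall rho, Q rho -> pdo rho /\ sat rho b) -> ale (alpha Q) b.
Proof. by move=> Qb; apply: (ws_meet_lb ws). Qed.

Lemma sat_combine2 (x y : R) rho sigma a : 0 < x -> 0 < y ->
  pdo rho -> pdo sigma -> pdo (combine2 x y rho sigma) ->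
  (sat (combine2 x y rho sigma) a <-> sat rho a /\ sat sigma a).
Proof.
move=> x0 y0 rp sp cp.
pose xs (i : 'I_2) := if i == ord0 then x else y.
pose rs (i : 'I_2) := if i == ord0 then rho else sigma.
have E : combine2 x y rho sigma = (fun u v => \sum_(i < 2) (xs i)%:C%C * rs i u v).
  by apply: op_ext => u v; rewrite big_ord_recl big_ord1.
have := @ws_conv _ _ _ _ _ _ ws a 1 xs rs; rewrite -E => -[| | |h1 h2].
- by move=> i; rewrite /rs; case: ifP.
- by move=> i; rewrite /xs; case: ifP.
- by [].
split=> [/h1 h|[ra sa]]; last by apply: h2 => i; rewrite /rs; case: ifP.
by split; [exact: (h ord0)|exact: (h (lift ord0 ord0))].
Qed.

(** The weakest precondition of [c]: linearity of [sem S] carries a combination to its image, where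
    [ws_conv] applies. *)
Lemma face_wp S c : wf S -> face (fun rho => pdo rho /\ sat (sem S rho) c).
Proof.
move=> wS x y rho sigma x0 y0 rp sp cp.
have E : sem S (combine2 x y rho sigma) = combine2 x y (sem S rho) (sem S sigma).
  by apply: (qop_lin (qop_sem wS)); rewrite ?ler0c ?ltW //; [exact: rp.1|exact: sp.1].
have := @sat_combine2 x y (sem S rho) (sem S sigma) c x0 y0; rewrite -E.
move=> /(_ (pdo_sem wS rp) (pdo_sem wS sp) (pdo_sem wS cp)) H.
split=> [[_ /H[]]|[[_ h1] [_ h2]]] //; split=> //; exact/H.
Qed.

Lemma psd_op0 : psd (@op0 R n).
Proof. by move=> v; rewrite big1 // => x _; rewrite big1 // => y _; rewrite mulr0 mul0r. Qed.

Lemma pdo_op0 : pdo (@op0 R n).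
Proof. by split; [exact: psd_op0|rewrite /trace big1]. Qed.

Lemma sem_op0 S : wf S -> sem S (@op0 R n) = @op0 R n.
Proof.
move=> wS; have := qop_lin (qop_sem wS) (lexx 0) (lexx 0) psd_op0 psd_op0.
have -> B D : opD (opZ 0 B) (opZ 0 D) = @op0 R n.
  by apply: op_ext => x y; rewrite /opD /opZ !mul0r addr0.
by move=> ->; apply: op_ext => x y; rewrite /opD /opZ !mul0r addr0.
Qed.

(** Split [rho] as [1 rho + 1 0] and apply the convexity condition. *)
Lemma sat_op0 rho a : pdo rho -> sat rho a -> sat (@op0 R n) a.
Proof.
move=> rp ra.
have E : combine2 1 1 rho (@op0 R n) = rho.
  by apply: op_ext => x y; rewrite /combine2 /opD /opZ !mul1r addr0.
have := @sat_combine2 1 1 rho (@op0 R n) a; rewrite E.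
by move=> /(_ ltr01 ltr01 rp pdo_op0 rp)[/(_ ra)[]].
Qed.

Lemma spost_alpha_le S Q : wf S -> (forall rho, Q rho -> pdo rho) ->
  ale (spost S (alpha Q)) (alpha (sem_set S Q)).
Proof.
move=> wS Qp; set c := alpha (sem_set S Q).
have SQp sigma : sem_set S Q sigma -> pdo sigma.
  by move=> [rho /Qp rp ->]; apply: pdo_sem.
have Qc rho : Q rho -> pdo rho /\ sat (sem S rho) c.
  by move=> Qr; split; [exact: Qp|apply: alpha_sat => //; exists rho].
have [n0|n0] := posnP n.
  apply: (ws_meet_lb ws) => rho rp ra; rewrite sem_qubitless //.
  suff : ale (alpha Q) c by apply.
  by apply: alpha_lb => sigma /Qc; rewrite sem_qubitless.
(* If the face is empty, so is [Q], whence [alpha Q] is below [c]. A state satisfying [alpha Q]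
   would make the zero state satisfy [c], and zero would lie in the face; so there is no such
   state. *)
have [Gne|Gempty] := pselect (exists rho, pdo rho /\ sat (sem S rho) c); last first.
  apply: (ws_meet_lb ws) => rho rp ra; case: (Gempty); exists (@op0 R n).
  split; [exact: pdo_op0|rewrite sem_op0 //].
  apply: (sat_op0 rp); suff : ale (alpha Q) c by apply.
  by apply: alpha_lb => sigma /Qc Gs; case: Gempty; exists sigma.
have [P [Pp PG GP]] := face_projector (@face_wp S c wS) (fun rho => @proj1 _ _) Gne.
pose T := Assert (full_op P).
have wT : wf T by apply: wf_assert_full.
have semT : sem T = kraus P by apply: sem_assert_full.
(* The meet of the empty family, satisfied by every state by [ws_meet_sat]. *)
pose top := meet (fun=> False).
have dT : derivable sat IN T top (alpha Q).
  (* If [b] holds after [T] from every state, it holds on [Q], since each member of [Q] is its own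
     image under [T]. *)
  apply: IN_complete => //; apply: (ws_meet_glb ws) => b Tb; apply: alpha_lb => rho Qr.
  split; first exact: Qp.
  rewrite -(GP rho (Qc _ Qr)) -semT; apply: Tb; first exact: Qp.
  by apply: (ws_meet_sat ws) => //; apply: Qp.
have dS : derivable sat IN S (alpha Q) (spost S (alpha Q)) by apply: IN_complete.
have wTS : wf (Seq T S) by [].
(* Soundness puts [spost S (alpha Q)] below [spost (Seq T S) top]. That is below [c], because [T]
   maps every state into the face. *)
move=> rho rp /(IN_sound wTS (d_seq dT dS) rp); move: rho rp.
apply: (ws_meet_lb ws) => rho rp _.
by change (sat (sem S (sem T rho)) c); rewrite semT; have [] := PG _ rp.
Qed.

Lemma alpha_le_spost S Q : wf S -> (forall rho, Q rho -> pdo rho) ->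
  ale (alpha (sem_set S Q)) (spost S (alpha Q)).
Proof.
move=> wS Qp; apply: (ws_meet_glb ws) => b Sb; apply: alpha_lb => _ [rho Qr ->].
split; first exact/pdo_sem/Qp.
by apply: Sb; [exact: Qp|exact: alpha_sat].
Qed.

End Completeness.

Theorem mainTheorem14 (R : realType) (n : nat) (A : Type)
    (sat : op R n -> A -> Prop) (meet join : (A -> Prop) -> A)
    (IN : in_schemas R n A) :
  well_structured sat meet join ->
  sound sat meet IN -> rel_complete sat meet IN ->
  forall S : prog R n, wf S ->
  forall Q : op R n -> Prop, (forall rho, Q rho -> pdo rho) ->
    alpha sat meet (sem_set S Q) = sem_sharp sat join IN S (alpha sat meet Q).
Proof.
move=> ws sd rc S wS Q Qp; rewrite (sem_sharpE ws sd rc) //.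
apply: (ws_antisym ws); first exact: (alpha_le_spost ws).
exact: (spost_alpha_le ws sd rc).
Qed.
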